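(* Let $\Bbbk$ be a field of characteristic zero and let $(\mathfrak g,\langle\cdot,\cdot\rangle_{\mathfrak g},\alpha_{\mathfrak g},\beta_{\mathfrak g},\omega_{\mathfrak g})$ be a qhl-algebra over $\Bbbk$. Let $\hat{\mathfrak g}=\mathfrak g\otimes_\Bbbk\Bbbk[t,t^{-1}]$, with the bilinear product determined by $$\langle x\otimes t^n,y\otimes t^m\rangle_{\hat{\mathfrak g}}=\langle x,y\rangle_{\mathfrak g}\otimes t^{n+m}\qquad(x,y\in\mathfrak g,\ n,m\in\mathbb Z),$$ and put $\alpha_{\hat{\mathfrak g}}=\alpha_{\mathfrak g}\otimes\mathrm{id}$, $\beta_{\hat{\mathfrak g}}=\beta_{\mathfrak g}\otimes\mathrm{id}$ and $\omega_{\hat{\mathfrak g}}=\omega_{\mathfrak g}\otimes\mathrm{id}$, i.e. $\omega_{\hat{\mathfrak g}}(x\otimes t^n,y\otimes t^m)=\omega_{\mathfrak g}(x,y)\otimes\mathrm{id}$ for $(x,y)\in D_{\omega_{\mathfrak g}}$ and $n,m\in\mathbb Z$. Then the vector space $\hat{\mathfrak g}$ admits the structure of a qhl-algebra $(\hat{\mathfrak g},\langle\cdot,\cdot\rangle_{\hat{\mathfrak g}},\alpha_{\hat{\mathfrak g}},\beta_{\hat{\mathfrak g}},\omega_{\hat{\mathfrak g}})$.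
   Context: Throughout, $\Bbbk$ is a field of characteristic zero and $\mathcal L_\Bbbk(V)$ is the space of $\Bbbk$-linear endomorphisms of a $\Bbbk$-linear space $V$. $\circlearrowleft_{x,y,z}$ denotes cyclic summation over $x,y,z$. Qhl-algebra: a quasi-hom-Lie algebra (qhl-algebra) is a tuple $(L,\langle\cdot,\cdot\rangle_L,\alpha,\beta,\omega)$ where $L$ is a $\Bbbk$-linear space, $\langle\cdot,\cdot\rangle_L:L\times L\to L$ is bilinear, $\alpha,\beta:L\to L$ are linear maps, and $\omega:D_\omega\to\mathcal L_\Bbbk(L)$ is a map with domain $D_\omega\subseteq L\times L$, such that: (1) $\langle\alpha(x),\alpha(y)\rangle_L=\beta\circ\alpha\langle x,y\rangle_L$ for all $x,y\in L$; (2) $\langle x,y\rangle_L=\omega(x,y)\langle y,x\rangle_L$ for all $(x,y)\in D_\omega$; (3) $\circlearrowleft_{x,y,z}\big\{\omega(z,x)\big(\langle\alpha(x),\langle y,z\rangle_L\rangle_L+\beta\langle x,\langle y,z\rangle_L\rangle_L\big)\big\}=0$ for all $(z,x),(x,y),(y,z)\in D_\omega$. The map $\omega_{\hat{\mathfrak g}}=\omega_{\mathfrak g}\otimes\mathrm{id}$ is regarded as having domain $D_{\omega_{\hat{\mathfrak g}}}=\{(x\otimes t^n,y\otimes t^m):(x,y)\in D_{\omega_{\mathfrak g}},\ n,m\in\mathbb Z\}$; here $\omega_{\mathfrak g}(x,y)\otimes\mathrm{id}$ is the endomorphism $v\otimes p\mapsto\omega_{\mathfrak g}(x,y)(v)\otimes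 p$ of $\hat{\mathfrak g}$. *)

(* Defs.v *)
From HB Require Import structures.
From mathcomp Require Import all_boot all_order all_algebra.
From mathcomp Require Import boolp classical_sets.
From mathcomp Require Import finmap monalg.

Set Implicit Arguments.
Unset Strict Implicit.
Unset Printing Implicit Defensive.

Import GRing.Theory.
Local Open Scope ring_scope.
Local Open Scope quotient_scope.

Section Tensor.
Variables (R : comNzRingType) (U V : lmodType R).

(* The free module on U * V; [tensor] below is its quotient by the submodule
   that the bilinearity relations generate, for modules of any rank. *)
Local Notation free := {malg R[(U * V)%type]}.

Inductive tensor_relation : free -> Prop :=
| TRel0 : tensor_relation 0
| TRelP a f g : tensor_relation f -> tensor_relation g ->
    tensor_relation (a *: f + g)
| TRelL a u u' v : tensor_relation
    (<< (a *: u + u', v) >> - (a *: << (u, v) >> + << (u', v) >>))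
| TRelR a u v v' : tensor_relation
    (<< (u, a *: v + v') >> - (a *: << (u, v) >> + << (u, v') >>)).

Definition tensor_null : {pred free} := [pred f | `[< tensor_relation f >]].

Lemma tensor_nullP f : reflect (tensor_relation f) (f \in tensor_null).
Proof. exact: asboolP. Qed.

Lemma tensor_null_submod : submod_closed tensor_null.
Proof.
split=> [|a f g /tensor_nullP Hf /tensor_nullP Hg]; apply/tensor_nullP.
  exact: TRel0.
exact: TRelP.
Qed.

HB.instance Definition _ :=
  GRing.isSubmodClosed.Build R free tensor_null tensor_null_submod.

Definition tensor : Type := Quotient.quot tensor_null.

HB.instance Definition _ := GRing.Zmodule.on tensor.

Definition tensor_pi (f : free) : tensor := \pi_(Quotient.quot tensor_null) f.

Lemma tensor_piP f g :
  reflect (tensor_pi f = tensor_pi g) (f - g \in tensor_null).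
Proof. by rewrite Quotient.idealrBE; apply: eqP. Qed.

Lemma tensor_piB : zmod_morphism tensor_pi.
Proof. exact: (@pi_is_zmod_morphism _ _ _ (Quotient.quot tensor_null)). Qed.

HB.instance Definition _ := GRing.isZmodMorphism.Build free tensor tensor_pi
  tensor_piB.

Definition tensor_repr (x : tensor) : free :=
  repr (x : Quotient.quot tensor_null).

Lemma tensor_reprK : cancel tensor_repr tensor_pi.
Proof. exact: reprK. Qed.

Definition tensor_scale (a : R) (x : tensor) : tensor :=
  tensor_pi (a *: tensor_repr x).

Lemma tensor_scale_pi a f : tensor_scale a (tensor_pi f) = tensor_pi (a *: f).
Proof.
apply/tensor_piP; rewrite -scalerBr rpredZ //; apply/tensor_piP.
exact: tensor_reprK.
Qed.

Lemma tensor_scaleA a b x :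
  tensor_scale a (tensor_scale b x) = tensor_scale (a * b) x.
Proof. by rewrite -[x]tensor_reprK !tensor_scale_pi scalerA. Qed.

Lemma tensor_scale1 : left_id 1 tensor_scale.
Proof. by move=> x; rewrite -[x]tensor_reprK tensor_scale_pi scale1r. Qed.

Lemma tensor_scaleDr : right_distributive tensor_scale +%R.
Proof.
move=> a x y; rewrite -[x]tensor_reprK -[y]tensor_reprK.
by rewrite -raddfD !tensor_scale_pi scalerDr raddfD.
Qed.

Lemma tensor_scaleDl x : {morph tensor_scale^~ x : a b / a + b}.
Proof.
by move=> a b; rewrite -[x]tensor_reprK !tensor_scale_pi scalerDl raddfD.
Qed.

HB.instance Definition _ := GRing.Zmodule_isLmodule.Build R tensor
  tensor_scaleA tensor_scale1 tensor_scaleDr tensor_scaleDl.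

Lemma tensor_piZ : scalable tensor_pi.
Proof. by move=> a f; rewrite -tensor_scale_pi. Qed.

HB.instance Definition _ := GRing.isScalable.Build R free tensor *:%R
  tensor_pi tensor_piZ.

Definition tens (u : U) (v : V) : tensor := tensor_pi << (u, v) >>.

Lemma tens_bilinear : bilinear_for *:%R *:%R tens.
Proof.
split=> [v a u u'|u a v v'] /=; rewrite -linearP /=; apply/tensor_piP/tensor_nullP.
  exact: TRelL.
exact: TRelR.
Qed.

HB.instance Definition _ :=
  bilinear_isBilinear.Build R U V tensor *:%R *:%R tens tens_bilinear.

Section UniversalProperty.
Variables (W : lmodType R).

Lemma tensor_linear_ext (f g : {linear tensor -> W}) :
  (forall u v, f (tens u v) = g (tens u v)) -> f =1 g.
Proof.
move=> fg x; rewrite -[x]tensor_reprK [tensor_repr x]monalgE !raddf_sum /=.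
apply: eq_bigr => -[u v] _.
set c := (X in << X *g _ >>).
have -> : << c *g (u, v) >> = c *: (<< (u, v) >> : free).
  by apply/malgP => k; rewrite mcoeffZ !mcoeffU mulr_natr.
by rewrite !linearZ /= -/(tens u v) fg.
Qed.

Variable b : {bilinear U -> V -> W}.

Definition free_lift (f : free) : W :=
  \sum_(k <- msupp f) f@_k *: b k.1 k.2.

Lemma free_liftEw (d : {fset (U * V)%type}) f : (msupp f `<=` d)%fset ->
  free_lift f = \sum_(k <- d) f@_k *: b k.1 k.2.
Proof.
move=> sfd; rewrite /free_lift (big_fset_incl _ sfd) //= => k _ kf.
by rewrite mcoeff_outdom // scale0r.
Qed.

Lemma free_lift_linear : linear free_lift.
Proof.
move=> a f g; pose d := (msupp f `|` msupp g `|` msupp (a *: f + g))%fset.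
have [sf sg sfg] : [/\ msupp f `<=` d, msupp g `<=` d
    & msupp (a *: f + g) `<=` d]%fset.
  split; apply/fsubsetP => k; rewrite !in_fsetU => -> //.
    by rewrite orbT.
  by rewrite !orbT.
rewrite (free_liftEw sf) (free_liftEw sg) (free_liftEw sfg) scaler_sumr.
rewrite -big_split /=; apply: eq_bigr => k _.
by rewrite mcoeffD mcoeffZ scalerDl scalerA.
Qed.

HB.instance Definition _ := GRing.isLinear.Build R free W *:%R free_lift
  free_lift_linear.

Lemma free_liftU u v : free_lift << (u, v) >> = b u v.
Proof.
rewrite (@free_liftEw [fset (u, v)]%fset) ?msuppU_le //.
by rewrite big_seq_fset1 mcoeffUU scale1r.
Qed.

Lemma free_lift_null f : tensor_relation f -> free_lift f = 0.
Proof.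
elim=> {f} [|a f g _ f0 _ g0|a u u' v|a u v v'].
- exact: linear0.
- by rewrite linearP /= f0 g0 scaler0 addr0.
- rewrite linearB linearP /= !free_liftU; apply/eqP; rewrite subr_eq0.
  by rewrite linearPl.
- rewrite linearB linearP /= !free_liftU; apply/eqP; rewrite subr_eq0.
  by rewrite linearPr.
Qed.

Definition tensor_lift (x : tensor) : W := free_lift (tensor_repr x).

Lemma tensor_lift_pi f : tensor_lift (tensor_pi f) = free_lift f.
Proof.
apply/eqP; rewrite -subr_eq0 -linearB /=; apply/eqP/free_lift_null.
by apply/tensor_nullP/tensor_piP; rewrite tensor_reprK.
Qed.

Lemma tensor_lift_linear : linear tensor_lift.
Proof.
move=> a x y; rewrite -[x]tensor_reprK -[y]tensor_reprK -linearP /=.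
by rewrite !tensor_lift_pi linearP.
Qed.

HB.instance Definition _ := GRing.isLinear.Build R tensor W *:%R tensor_lift
  tensor_lift_linear.

Lemma tensor_lift_tens u v : tensor_lift (tens u v) = b u v.
Proof. by rewrite tensor_lift_pi free_liftU. Qed.

End UniversalProperty.
End Tensor.

Section TensorMap.
Variables (R : comNzRingType) (U V U' V' : lmodType R).
Variables (f : {linear U -> U'}) (g : {linear V -> V'}).

Definition tens_map (u : U) (v : V) : tensor U' V' := tens (f u) (g v).

Lemma tens_map_bilinear : bilinear_for *:%R *:%R tens_map.
Proof.
split=> [v a u u'|u a v v'] /=; rewrite /tens_map linearP.
  exact: linearPl.
exact: linearPr.
Qed.

HB.instance Definition _ := bilinear_isBilinear.Build R U V (tensor U' V')
  *:%R *:%R tens_map tens_map_bilinear.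

Definition tensor_map : {linear tensor U V -> tensor U' V'} :=
  tensor_lift tens_map.

Lemma tensor_map_tens u v : tensor_map (tens u v) = tens (f u) (g v).
Proof. exact: tensor_lift_tens. Qed.

End TensorMap.

Section QhlAlgebra.
Variables (k : fieldType) (L : lmodType k).
Local Open Scope classical_set_scope.

(* [omega] is defined on D only: D, of type [set (L * L)], is coerced to the
   type of its elements. *)
Record is_qhl_algebra (br : {bilinear L -> L -> L}) (alpha beta : {linear L -> L})
    (D : set (L * L)) (omega : D -> {linear L -> L}) : Prop := IsQhlAlgebra {
  qhl_twist : forall x y, br (alpha x) (alpha y) = beta (alpha (br x y));
  qhl_omega_symm : forall x y (xy : (x, y) \in D),
    br x y = omega (exist _ (x, y) xy) (br y x);
  qhl_jacobi : forall x y z (zx : (z, x) \in D) (xy : (x, y) \in D)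
      (yz : (y, z) \in D),
    omega (exist _ (z, x) zx) (br (alpha x) (br y z) + beta (br x (br y z)))
    + omega (exist _ (x, y) xy) (br (alpha y) (br z x) + beta (br y (br z x)))
    + omega (exist _ (y, z) yz) (br (alpha z) (br x y) + beta (br z (br x y)))
    = 0
}.

End QhlAlgebra.

(* k[t, t^-1] as a k-module: finitely supported functions from int to k, with
   t^n the indicator of n. [monalg] has no ring structure here, since it asks
   that the monoid of monomials have no unit but 1; only t^n t^m = t^(n + m)
   enters, and it is written out where needed. *)
Notation laurent k := {malg k[int]}.

Definition tpow (k : fieldType) (n : int) : laurent k := << n >>.

Section Loop.
Variables (k : fieldType) (g : lmodType k).
Local Open Scope classical_set_scope.

Definition loop : Type := tensor g (laurent k).

HB.instance Definition _ := GRing.Lmodule.on loop.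

Definition loop_monomial (x : g) (n : int) : loop := tens x (tpow k n).

Definition loop_map (f : {linear g -> g}) : {linear loop -> loop} :=
  tensor_map f idfun.

Definition is_loop_bracket (br : g -> g -> g) (brh : loop -> loop -> loop) :=
  forall x y n m, brh (loop_monomial x n) (loop_monomial y m)
                  = loop_monomial (br x y) (n + m).

Definition loop_dom (D : set (g * g)) : set (loop * loop) :=
  [set p | exists x y n m,
     D (x, y) /\ p = (loop_monomial x n, loop_monomial y m)].

(* The monomials x t^n do not determine n when x = 0; the equation is required
   for every way of writing a point of the domain as a pair of monomials. *)
Definition is_loop_omega (D : set (g * g)) (omega : D -> {linear g -> g})
    (omegah : loop_dom D -> {linear loop -> loop}) :=
  forall x y n m (xy : (x, y) \in D)
    (xyh : (loop_monomial x n, loop_monomial y m) \in loop_dom D),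
    omegah (exist _ (loop_monomial x n, loop_monomial y m) xyh)
    =1 loop_map (omega (exist _ (x, y) xy)).

End Loop.

(* Main.v *)
(** All the axioms hold on monomials x t^n, where they are the axioms of g times
    a power of t, and the bracket identities extend to the loop space because
    monomials span it. The one point that needs care is that omega is
    well defined on pairs of monomials: evaluation at t = 1 recovers x from
    x t^n, so the pair (x, y) is determined by (x t^n, y t^m), even though n is
    not when x = 0. *)
Require Import Defs.
From HB Require Import structures.
From mathcomp Require Import all_boot all_order all_algebra.
From mathcomp Require Import boolp classical_sets.
From mathcomp Require Import functions finmap monalg.
Set Implicit Arguments.
Unset Strict Implicit.
Unset Printing Implicit Defensive.
Import GRing.Theory.
Local Open Scope ring_scope.

(** * Preliminaries on linear and bilinear maps *)

Lemma linear_combC (R : comNzRingType) (W : lmodType R) a b (u u' v v' : W) :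
  b *: (a *: u + u') + (a *: v + v') = a *: (b *: u + v) + (b *: u' + v').
Proof. by rewrite !scalerDr !scalerA mulrC addrACA. Qed.

Lemma linear_for0 (R : comNzRingType) (U V : lmodType R) (f : U -> V) :
  linear f -> f 0 = 0.
Proof.
by move=> fL; have := fL (-1) 0 0; rewrite scaler0 addr0 scaleN1r addNr.
Qed.

Lemma bilinear_forP (R : comNzRingType) (U V W : lmodType R)
  (b : {bilinear U -> V -> W}) : bilinear_for *:%R *:%R b.
Proof. by split=> [v a u u'|u a v v'] /=; [apply: linearPl|apply: linearPr]. Qed.

Lemma bilinear_precomp (R : comNzRingType) (U V : lmodType R)
    (b : {bilinear U -> U -> V}) (f : {linear U -> U}) :
  bilinear_for *:%R *:%R (fun x y => b (f x) (f y)).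
Proof. by split=> [v a u u'|u a v v'] /=; rewrite linearP (linearPl, linearPr). Qed.

Lemma bilinear_postcomp (R : comNzRingType) (U V : lmodType R)
    (b : {bilinear U -> U -> V}) (h : {linear V -> V}) :
  bilinear_for *:%R *:%R (fun x y => h (b x y)).
Proof. by split=> [v a u u'|u a v v'] /=; rewrite (linearPl, linearPr) linearP. Qed.

(** * Linear maps out of a free module *)

Section MalgLift.
Variables (R : comNzRingType) (K : choiceType).

Lemma malg_ind (P : {malg R[K]} -> Prop) :
  P 0 -> (forall a f g, P f -> P g -> P (a *: f + g)) ->
  (forall k, P << k >>) -> forall f, P f.
Proof.
move=> P0 PD PU f; rewrite [f]monalgE.
elim/big_ind: _ => // [f1 f2 Pf1 Pf2|k _]; first by rewrite -[f1]scale1r; apply: PD.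
(* The added 0 gives the term the shape [a *: f + g] that [PD] expects. *)
have -> : << f@_k *g k >> = f@_k *: (<< k >> : {malg R[K]}) + 0.
  by rewrite addr0; apply/malgP => k'; rewrite mcoeffZ !mcoeffU mulr_natr.
exact: PD.
Qed.

Variables (W : lmodType R) (h : K -> W).

Definition malg_lift (f : {malg R[K]}) : W := \sum_(k <- msupp f) f@_k *: h k.

(** Enlarging the index set adds only zero coefficients, so lifts of elements with different
    supports can be compared as sums over one common set. *)
Lemma malg_liftEw (d : {fset K}) f : (msupp f `<=` d)%fset ->
  malg_lift f = \sum_(k <- d) f@_k *: h k.
Proof.
move=> sfd; rewrite /malg_lift (big_fset_incl _ sfd) //= => k _ kf.
by rewrite mcoeff_outdom // scale0r.
Qed.

Lemma malg_lift_linear : linear malg_lift.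
Proof.
move=> a f g; pose d := (msupp f `|` msupp g `|` msupp (a *: f + g))%fset.
have sf : (msupp f `<=` d)%fset by rewrite /d -fsetUA fsubsetUl.
have sg : (msupp g `<=` d)%fset by rewrite /d fsetUAC fsubsetUr.
rewrite (malg_liftEw sf) (malg_liftEw sg) (@malg_liftEw d) ?fsubsetUr //.
rewrite scaler_sumr -big_split /=; apply: eq_bigr => k _.
by rewrite mcoeffD mcoeffZ scalerDl scalerA.
Qed.

HB.instance Definition _ :=
  GRing.isLinear.Build R {malg R[K]} W *:%R malg_lift malg_lift_linear.

Lemma malg_liftU k : malg_lift << k >> = h k.
Proof.
by rewrite (@malg_liftEw [fset k]%fset) ?msuppU_le // big_seq_fset1 mcoeffUU scale1r.
Qed.

End MalgLift.

(** * Bilinear maps on free modules and the product of Laurent polynomials *)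

Section MalgLift2.
Variables (R : comNzRingType) (K K' : choiceType) (W : lmodType R).
Variable h : K -> K' -> W.

Definition malg_lift2 (p : {malg R[K]}) (q : {malg R[K']}) : W :=
  malg_lift (fun i => malg_lift (h i) q) p.

Lemma malg_lift2_bilinear : bilinear_for *:%R *:%R malg_lift2.
Proof.
have Pl q : linear (malg_lift2^~ q) by exact: malg_lift_linear.
have Zl q : malg_lift2 0 q = 0 by rewrite /malg_lift2 linear0.
split=> [//|p a q q'] /=; elim/malg_ind: p => [|b p p' IHp IHp'|n].
- by rewrite !Zl scaler0 addr0.
(* Linearity in the second argument passes to combinations in the first because the two kinds of
   combination commute; the same interchange serves for the tensor products below. *)
- by rewrite !Pl IHp IHp' linear_combC.
- by rewrite /malg_lift2 !malg_liftU malg_lift_linear.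
Qed.

HB.instance Definition _ := bilinear_isBilinear.Build R {malg R[K]} {malg R[K']} W
  *:%R *:%R malg_lift2 malg_lift2_bilinear.

Lemma malg_lift2UU i j : malg_lift2 << i >> << j >> = h i j.
Proof. by rewrite /malg_lift2 !malg_liftU. Qed.

End MalgLift2.

(** The product of the algebra of Laurent polynomials, kept as a mere bilinear map with [<< n >>]
    standing for the n-th power of t. *)
Definition laurent_mul (R : comNzRingType) :
    {bilinear {malg R[int]} -> {malg R[int]} -> {malg R[int]}} :=
  malg_lift2 (fun n m : int => << n + m >>).

Lemma laurent_mulUU (R : comNzRingType) (n m : int) :
  laurent_mul R << n >> << m >> = << n + m >>.
Proof. exact: malg_lift2UU. Qed.

(** * The product on a tensor product of two spaces with bilinear products *)

Section TensorBilinear.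
Variables (R : comNzRingType) (U V : lmodType R).

Lemma tensor_ind (P : tensor U V -> Prop) :
  P 0 -> (forall a x y, P x -> P y -> P (a *: x + y)) ->
  (forall u v, P (tens u v)) -> forall x, P x.
Proof.
move=> P0 PD PU x; rewrite -[x]tensor_reprK.
elim/malg_ind: (tensor_repr x) => [|a f g Pf Pg|[u v]]; last exact: PU.
  by rewrite raddf0.
by rewrite linearP; apply: PD.
Qed.

Variables (b : {bilinear U -> U -> U}) (c : {bilinear V -> V -> V}).

(** Left multiplication by a pure tensor. Its values are taken in the module of all functions, so
    that the universal property extends it to every left factor; linearity in the right factor is
    recovered in [tensor_mul_bilinear]. *)
Definition tens_mul (u : U) (v : V) : tensor U V -> tensor U V :=
  tensor_map (b u) (c v).

Lemma tens_mul_bilinear : bilinear_for *:%R *:%R tens_mul.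
Proof.
have TE u v u' v' : tens_mul u v (tens u' v') = tens (b u u') (c v v').
  exact: tensor_map_tens.
have T0 u v : tens_mul u v 0 = 0 by exact: linear0.
have TP u v a y y' : tens_mul u v (a *: y + y') = a *: tens_mul u v y + tens_mul u v y'.
  exact: linearP.
split=> [v a u u'|u a v v'] /=.
- suff E y : tens_mul (a *: u + u') v y = a *: tens_mul u v y + tens_mul u' v y.
    exact/funext/E.
  elim/tensor_ind: y => [|e y y' IHy IHy'|w z].
  + by rewrite !T0 scaler0 addr0.
  + by rewrite !TP IHy IHy'; exact: linear_combC.
  + by rewrite !TE !linearPl.
- suff E y : tens_mul u (a *: v + v') y = a *: tens_mul u v y + tens_mul u v' y.
    exact/funext/E.
  elim/tensor_ind: y => [|e y y' IHy IHy'|w z].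
  + by rewrite !T0 scaler0 addr0.
  + by rewrite !TP IHy IHy'; exact: linear_combC.
  + by rewrite !TE linearPl linearPr.
Qed.

HB.instance Definition _ := bilinear_isBilinear.Build R U V
  (tensor U V -> tensor U V) *:%R *:%R tens_mul tens_mul_bilinear.

Definition tensor_mul (x y : tensor U V) : tensor U V := tensor_lift tens_mul x y.

Lemma tensor_mul_tensl u v y : tensor_mul (tens u v) y = tensor_map (b u) (c v) y.
Proof. by rewrite /tensor_mul tensor_lift_tens. Qed.

Lemma tensor_mul_bilinear : bilinear_for *:%R *:%R tensor_mul.
Proof.
have Pl y : linear (tensor_mul^~ y).
  by move=> a x x'; rewrite /tensor_mul linearP.
have Zl y : tensor_mul 0 y = 0 by rewrite /tensor_mul linear0.
split=> [|x a y y'] /=; first exact: Pl.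
elim/tensor_ind: x => [|e x x' IHx IHx'|u v].
- by rewrite !Zl scaler0 addr0.
- by rewrite !Pl IHx IHx'; exact: linear_combC.
- by rewrite !tensor_mul_tensl linearP.
Qed.

HB.instance Definition _ := bilinear_isBilinear.Build R (tensor U V) (tensor U V)
  (tensor U V) *:%R *:%R tensor_mul tensor_mul_bilinear.

Lemma tensor_mul_tens u v u' v' :
  tensor_mul (tens u v) (tens u' v') = tens (b u u') (c v v').
Proof. by rewrite tensor_mul_tensl tensor_map_tens. Qed.

End TensorBilinear.

Lemma tensor_malg_ind (R : comNzRingType) (U : lmodType R) (K : choiceType)
    (P : tensor U {malg R[K]} -> Prop) :
  P 0 -> (forall a x y, P x -> P y -> P (a *: x + y)) ->
  (forall u k, P (tens u << k >>)) -> forall x, P x.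
Proof.
move=> P0 PD PU; elim/tensor_ind => // u p.
elim/malg_ind: p => [|a p q Pp Pq|n]; last exact: PU.
  by rewrite linear0r.
have -> : tens u (a *: p + q) = a *: tens u p + tens u q.
  exact: (tens_bilinear _ _).2.
exact: PD Pp Pq.
Qed.

(** * Transfer of the axioms along monomials *)

(* [L] and [mon] are abstract: on [loop g] itself, a rewrite that compares two
   distinct monomials unfolds tensors down to finite maps and does not return.
   For the same reason explicit equality terms replace rewriting below. *)
Section Monomials.
Variables (k : fieldType) (g L : lmodType k) (mon : g -> int -> L).
Hypothesis mon_linear : forall n, linear (mon^~ n).
Hypothesis mon_inj : forall x y n m, mon x n = mon y m -> x = y.
Hypothesis mon_ind : forall P : L -> Prop,
  P 0 -> (forall a X Y, P X -> P Y -> P (a *: X + Y)) ->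
  (forall x n, P (mon x n)) -> forall X, P X.
Local Open Scope classical_set_scope.

(** Serves twice: for the twist axiom, and for uniqueness of the loop bracket. *)
Lemma monomial_bilinear_ext (b b' : L -> L -> L) :
  bilinear_for *:%R *:%R b -> bilinear_for *:%R *:%R b' ->
  (forall x y n m, b (mon x n) (mon y m) = b' (mon x n) (mon y m)) ->
  forall X Y, b X Y = b' X Y.
Proof.
move=> [bl br] [b'l b'r] bb' X Y; elim/mon_ind: X => [|a X X' IH IH'|x n].
- by rewrite (linear_for0 (bl Y)) (linear_for0 (b'l Y)).
- by rewrite (bl Y) (b'l Y) IH IH'.
elim/mon_ind: Y => [|a Y Y' IH IH'|y m].
- by rewrite (linear_for0 (br _)) (linear_for0 (b'r _)).
- by rewrite (br (mon x n)) (b'r (mon x n)) IH IH'.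
- exact: bb'.
Qed.

(** Only the twist axiom has to be extended by bilinearity. The other two are required only for
    pairs in [Dh], which consist of monomials, so they reduce directly to the axioms of [g]. *)
Lemma monomial_qhl (br : {bilinear g -> g -> g}) (alpha beta : {linear g -> g})
    (D : set (g * g)) (omega : D -> {linear g -> g})
    (brh : {bilinear L -> L -> L}) (alphah betah : {linear L -> L})
    (Dh : set (L * L)) (omegah : Dh -> {linear L -> L}) :
  (forall x y n m, brh (mon x n) (mon y m) = mon (br x y) (n + m)) ->
  (forall x n, alphah (mon x n) = mon (alpha x) n) ->
  (forall x n, betah (mon x n) = mon (beta x) n) ->
  (forall X Y, (X, Y) \in Dh ->
     exists x y n m, [/\ (x, y) \in D, X = mon x n & Y = mon y m]) ->
  (forall x y n m (xy : (x, y) \in D) (xyh : (mon x n, mon y m) \in Dh) u q,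
     omegah (exist _ (mon x n, mon y m) xyh) (mon u q)
     = mon (omega (exist _ (x, y) xy) u) q) ->
  is_qhl_algebra br alpha beta omega -> is_qhl_algebra brh alphah betah omegah.
Proof.
move=> brE alphaE betaE domP omegaE [twist symm jacobi]; split.
- apply: (monomial_bilinear_ext (bilinear_precomp brh alphah)
            (bilinear_postcomp brh (betah \o alphah))) => x y n m /=.
  by rewrite !(brE, alphaE, betaE) twist.
- move=> X Y XY; have [x [y [n [m [xy eX eY]]]]] := domP _ _ XY; subst X Y.
  by rewrite !brE (omegaE _ _ _ _ xy) -symm addrC.
- move=> X Y Z ZX XY YZ.
  have [z [x [p [n [zx eZ eX]]]]] := domP _ _ ZX; subst Z X.
  (* Each pair is decomposed separately, so every vector appears in two guises. [mon_inj] identifies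
     the vectors; the exponents may differ at zero vectors, and the goal keeps [n], [m], [p]. *)
  have [x' [y [n' [m [xy eX eY]]]]] := domP _ _ XY; subst Y.
  have [y' [z' [m' [p' [yz eY eZ]]]]] := domP _ _ YZ.
  have ex := mon_inj eX; have ey := mon_inj eY; have ez := mon_inj eZ.
  subst x' y' z'; rewrite !brE !alphaE !brE !betaE.
  (* All three cyclic terms carry the same total power of t, hence merge into one monomial whose
     vector is the Jacobi sum in [g]. *)
  have -> : m + (p + n) = n + (m + p) by rewrite addrA addrC.
  have -> : p + (n + m) = n + (m + p) by rewrite addrC addrA.
  have monD u v q : mon u q + mon v q = mon (u + v) q.
    by have := mon_linear q 1 u v; rewrite !scale1r.
  rewrite !monD (omegaE _ _ _ _ zx) (omegaE _ _ _ _ xy) (omegaE _ _ _ _ yz).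
  by rewrite !monD jacobi (linear_for0 (mon_linear _)).
Qed.

End Monomials.

(** * The loop space and its structure maps *)

Section LoopAlgebra.
Variables (k : fieldType) (g : lmodType k).
Local Open Scope classical_set_scope.

Lemma loop_ind (P : loop g -> Prop) :
  P 0 -> (forall a X Y, P X -> P Y -> P (a *: X + Y)) ->
  (forall x n, P (loop_monomial x n)) -> forall X, P X.
Proof. exact: tensor_malg_ind. Qed.

Lemma loop_monomial_linear n : linear (fun x : g => loop_monomial x n).
Proof. exact: (tens_bilinear _ _).1. Qed.

Lemma loop_map_monomial (f : {linear g -> g}) x n :
  loop_map f (loop_monomial x n) = loop_monomial (f x) n.
Proof. exact: tensor_map_tens. Qed.

(** The lift of the constant 1 sums the coefficients of [p], which is its value at t = 1. *)
Definition eval1_tens (x : g) (p : {malg k[int]}) : g :=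
  malg_lift (fun=> 1 : k^o) p *: x.

Lemma eval1_tens_bilinear : bilinear_for *:%R *:%R eval1_tens.
Proof.
split=> [p a x y|x a p q] /=; rewrite /eval1_tens.
  by rewrite scalerDr !scalerA mulrC.
by rewrite linearP scalerDl scalerA.
Qed.

HB.instance Definition _ := bilinear_isBilinear.Build k g {malg k[int]} g
  *:%R *:%R eval1_tens eval1_tens_bilinear.

Definition loop_eval1 : loop g -> g := tensor_lift eval1_tens.

Lemma loop_eval1_monomial x n : loop_eval1 (loop_monomial x n) = x.
Proof. by rewrite /loop_eval1 tensor_lift_tens /= /eval1_tens malg_liftU scale1r. Qed.

Lemma loop_monomial_inj (x y : g) n m :
  loop_monomial x n = loop_monomial y m -> x = y.
Proof.
move=> /(congr1 loop_eval1) E.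
exact: (etrans (esym (loop_eval1_monomial x n)) (etrans E (loop_eval1_monomial y m))).
Qed.

Variable br : {bilinear g -> g -> g}.

Definition loop_br : {bilinear loop g -> loop g -> loop g} :=
  tensor_mul br (laurent_mul k).

Lemma loop_br_monomial : is_loop_bracket (k := k) br loop_br.
Proof.
by move=> x y n m; rewrite /loop_br /= tensor_mul_tens laurent_mulUU.
Qed.

Variables (D : set (g * g)) (omega : D -> {linear g -> g}).

(** Lets [omega] be applied to vectors computed from the point itself, with no choice of a way to
    write it as a pair of monomials. *)
Lemma loop_dom_eval1 (p : loop_dom D) :
  (loop_eval1 (val p).1, loop_eval1 (val p).2) \in D.
Proof.
case: p => p /= /set_mem [x [y [n [m [xy ->]]]]] /=.
rewrite (congr2 pair (loop_eval1_monomial x n) (loop_eval1_monomial y m)).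
exact: mem_set.
Qed.

Definition loop_omega (p : loop_dom D) : {linear loop g -> loop g} :=
  loop_map (omega (exist _ (_, _) (loop_dom_eval1 p))).

Lemma loop_omega_monomial : is_loop_omega omega loop_omega.
Proof.
move=> x y n m xy xyh X; rewrite /loop_omega.
(* Points of [D] with the same underlying pair are equal, whatever their membership proofs. *)
congr (loop_map (omega _) X); apply/val_inj.
exact: (congr2 pair (loop_eval1_monomial x n) (loop_eval1_monomial y m)).
Qed.

Lemma loop_domP X Y : (X, Y) \in loop_dom D ->
  exists x y n m, [/\ (x, y) \in D, X = loop_monomial x n & Y = loop_monomial y m].
Proof.
move=> /set_mem [x [y [n [m [xy [-> ->]]]]]].
by exists x, y, n, m; split=> //; apply/mem_set.
Qed.

Lemma loop_is_qhl (alpha beta : {linear g -> g}) :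
  is_qhl_algebra br alpha beta omega ->
  is_qhl_algebra loop_br (loop_map alpha) (loop_map beta) loop_omega.
Proof.
apply: (monomial_qhl loop_monomial_linear loop_monomial_inj (@loop_ind)
          loop_br_monomial (loop_map_monomial alpha) (loop_map_monomial beta)
          loop_domP).
move=> x y n m xy xyh u q.
exact: (etrans (loop_omega_monomial xy xyh _) (loop_map_monomial _ _ _)).
Qed.

End LoopAlgebra.

(** The second clause expresses that the bracket is determined by its values on monomials. *)
Theorem theorem6 (k : fieldType) (char0 : [pchar k] =i pred0) (g : lmodType k)
    (br : {bilinear g -> g -> g}) (alpha beta : {linear g -> g})
    (D : set (g * g)) (omega : D -> {linear g -> g}) :
  is_qhl_algebra br alpha beta omega ->
  exists (brh : {bilinear loop g -> loop g -> loop g})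
         (omegah : loop_dom D -> {linear loop g -> loop g}),
    [/\ is_loop_bracket br brh,
        forall b : {bilinear loop g -> loop g -> loop g},
          is_loop_bracket br b -> forall X Y, b X Y = brh X Y,
        is_loop_omega omega omegah
      & is_qhl_algebra brh (loop_map alpha) (loop_map beta) omegah].
Proof.
move=> qhl; exists (loop_br br), (loop_omega omega); split.
- exact: loop_br_monomial.
- move=> b bE; apply: (monomial_bilinear_ext (@loop_ind k g)).
  + exact: bilinear_forP.
  + exact: bilinear_forP.
  + move=> x y n m; exact: (etrans (bE x y n m) (esym (loop_br_monomial br x y n m))).
- exact: loop_omega_monomial.
- exact: loop_is_qhl.
Qed.
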